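(* Let $(\Omega,\Sigma,\mu)$ be a measure space, $\rho:\Omega\to(0,\infty)$ measurable, $M>m>0$, and let $f,g,h\in L^2_\rho(\Omega)$ with $h(x)\neq 0$ for a.e. $x\in\Omega$, be such that the functions $$M\cdot\frac{g}{h}-\frac{f}{h},\qquad \frac{f}{h}-m\cdot\frac{g}{h}$$ are synchronous on $\Omega$. For $u\in L^2_\rho(\Omega)$ write $$\Gamma(u,u):=\det\begin{pmatrix}\int_\Omega\rho u^2\,d\mu & \int_\Omega\rho uh\,d\mu\\ \int_\Omega\rho uh\,d\mu & \int_\Omega\rho h^2\,d\mu\end{pmatrix}.$$ Then $$0\le \Gamma(f,f)^{1/2}+\Gamma(g,g)^{1/2}-\Gamma(f+g,f+g)^{1/2}\le \frac12\cdot\frac{M-m}{\sqrt{M+m}}\,\Gamma(g,g)^{1/2}.$$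
   Context: $(\Omega,\Sigma,\mu)$ consists of a set $\Omega$, a $\sigma$-algebra $\Sigma$ of subsets of $\Omega$ and a countably additive positive measure $\mu$ on $\Sigma$ with values in $\mathbb{R}\cup\{\infty\}$. For measurable $\rho:\Omega\to(0,\infty)$, $L^2_\rho(\Omega)$ is the Hilbert space of real-valued measurable functions $f$ on $\Omega$ with $\int_\Omega\rho(s)|f(s)|^2\,d\mu(s)<\infty$. A pair of real-valued functions $(q,p)$ on $\Omega$ is synchronous if $(q(x)-q(y))(p(x)-p(y))\ge 0$ for a.e. $x,y\in\Omega$. *)

(* Defs.v *)
(* MathComp / MathComp-Analysis. *)
From HB Require Import structures.
From mathcomp Require Import all_boot all_order all_algebra.
From mathcomp Require Import all_classical all_reals all_analysis.

Set Implicit Arguments.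
Unset Strict Implicit.
Unset Printing Implicit Defensive.

Import Order.TTheory GRing.Theory Num.Theory.
Import numFieldNormedType.Exports.

Local Open Scope classical_set_scope.
Local Open Scope ring_scope.

(* Elements of L^2_rho are represented by functions rather than by classes of
   functions modulo a.e. equality. *)
Definition weightedL2 (d : measure_display) (T : measurableType d)
    (R : realType) (mu : {measure set T -> \bar R}) (rho f : T -> R) : Prop :=
  measurable_fun setT f /\
  (\int[mu]_x (rho x * `|f x| ^+ 2)%:E < +oo)%E.

(* "For a.e. x, y" is read as "for a.e. x, for a.e. y", which, unlike the
   product measure, requires no sigma-finiteness of mu. *)
Definition synchronous (d : measure_display) (T : measurableType d)
    (R : realType) (mu : {measure set T -> \bar R}) (q p : T -> R) : Prop :=
  {ae mu, forall x, {ae mu, forall y, 0 <= (q x - q y) * (p x - p y)}}.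

Definition weighted_ip (d : measure_display) (T : measurableType d)
    (R : realType) (mu : {measure set T -> \bar R}) (rho u v : T -> R) : R :=
  Rintegral mu setT (fun x => rho x * u x * v x).

(* The four 1 x 1 blocks are the entries of the 2 x 2 matrix. *)
Definition Gamma (d : measure_display) (T : measurableType d)
    (R : realType) (mu : {measure set T -> \bar R}) (rho h u : T -> R) : R :=
  \det (block_mx (weighted_ip mu rho u u)%:M (weighted_ip mu rho u h)%:M
                 (weighted_ip mu rho u h)%:M (weighted_ip mu rho h h)%:M
        : 'M[R]_(1 + 1)).

(* Main.v *)
(* Put G(u, v) = <u, v><h, h> - <u, h><v, h>.  Integrating the pointwise
   inequality 0 <= (u(x)h(y) - h(x)u(y)) (v(x)h(y) - h(x)v(y)) against
   rho(x) rho(y) first in y, then in x, gives 0 <= G(u, v), without Fubini.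
   With u = v this shows that G is positive semidefinite, hence Cauchy-Schwarz
   and the lower bound.  With u = M g - f, v = f - m g it gives
   (M + m) G(f, g) >= G(f, f) + M m G(g, g).  Writing a, b for the square roots
   of G(f, f), G(g, g) and c = G(f, g), the defect a b - c is then at most
   (a - m b)(M b - a) / (M + m), hence at most (M - m)^2 b^2 / (4 (M + m)) by
   AM-GM, and the upper bound follows from a + b - sqrt(a^2 + b^2 + 2 c) <=
   sqrt(a b - c), valid when 0 <= c <= a b. *)
Require Import Defs.
From HB Require Import structures.
From mathcomp Require Import all_boot all_order all_algebra.
From mathcomp Require Import all_classical all_reals all_analysis.
From mathcomp Require Import measurable_realfun ring lra.

Set Implicit Arguments.
Unset Strict Implicit.
Unset Printing Implicit Defensive.

Import Order.TTheory GRing.Theory Num.Theory.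
Import numFieldNormedType.Exports.

Local Open Scope classical_set_scope.
Local Open Scope ring_scope.

(** At [(s, t) = (B, - C)] the form equals [B * (A * B - C ^+ 2)], which settles [B > 0]. *)
Lemma discriminant_le (R : realFieldType) (A B C : R) :
  (forall s t, 0 <= s ^+ 2 * A + 2 * (s * t) * C + t ^+ 2 * B) ->
  0 <= B -> C ^+ 2 <= A * B.
Proof.
move=> Q; rewrite le_eqVlt => /predU1P[B0|B_gt0].
  (* With [B = 0] this choice of [t] collapses the form to [- C ^+ 2], which forces [C = 0]. *)
  have := Q C (- (A + 1) / 2); rewrite -B0 => H.
  by nra.
have H := Q B (- C).
rewrite -subr_ge0 -(pmulr_rge0 _ B_gt0).
by nra.
Qed.

(** With [s ^+ 2 = a * b - c], the radicand is [(a + b) ^+ 2 - 2 * s ^+ 2]. It exceeds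
    [(a + b - s) ^+ 2] by [s * (2 * (a + b) - 3 * s)], which is nonnegative because
    [s <= (a + b) / 2]. *)
Lemma sqrt_defect_le (R : rcfType) (a b c : R) :
  0 <= a -> 0 <= b -> 0 <= c -> c <= a * b ->
  a + b - Num.sqrt (a ^+ 2 + b ^+ 2 + 2 * c) <= Num.sqrt (a * b - c).
Proof.
move=> a0 b0 c0 cab; set s := Num.sqrt (a * b - c).
have s0 : 0 <= s by exact: sqrtr_ge0.
have s2 : s ^+ 2 = a * b - c by rewrite sqr_sqrtr // subr_ge0.
have s_le : s <= (a + b) / 2.
  rewrite -(ler_pXn2r (n := 2)) ?nnegrE //; last by lra.
  have := sqr_ge0 (a - b); nra.
suff : a + b - s <= Num.sqrt (a ^+ 2 + b ^+ 2 + 2 * c) by lra.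
have abs0 : 0 <= a + b - s by lra.
rewrite -(ger0_norm abs0) -sqrtr_sqr ler_wsqrtr //.
have : 0 <= s * ((a + b) / 2 - s) by apply: mulr_ge0 => //; lra.
by nra.
Qed.

Lemma sqrt_reverse_triangle_bounds (R : rcfType) (M m A B C : R) :
  0 < m -> m < M -> 0 <= A -> 0 <= B -> C ^+ 2 <= A * B ->
  A + M * m * B <= (M + m) * C ->
  0 <= Num.sqrt A + Num.sqrt B - Num.sqrt (A + B + 2 * C) /\
  Num.sqrt A + Num.sqrt B - Num.sqrt (A + B + 2 * C)
    <= 1 / 2 * ((M - m) / Num.sqrt (M + m)) * Num.sqrt B.
Proof.
move=> m0 mM A0 B0 CS hC.
have a0 := sqrtr_ge0 A; have b0 := sqrtr_ge0 B.
rewrite -(sqr_sqrtr A0) -(sqr_sqrtr B0) in CS hC *.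
rewrite !sqrtr_sqr !(ger0_norm a0) !(ger0_norm b0).
move: (Num.sqrt A) (Num.sqrt B) a0 b0 CS hC => a b a0 b0 CS hC {A B A0 B0}.
have k0 : 0 < M + m by lra.
have M0 : 0 < M by lra.
have ab0 : 0 <= a * b by exact: mulr_ge0.
have C0 : 0 <= C.
  rewrite -(pmulr_rge0 _ k0); apply: le_trans hC.
  by rewrite addr_ge0 ?sqr_ge0 // !mulr_ge0 ?sqr_ge0 // ltW.
have Cab : C <= a * b.
  by rewrite -(ler_pXn2r (n := 2)) ?nnegrE // exprMn.
split.
  rewrite subr_ge0 -[leRHS]ger0_norm ?addr_ge0 // -sqrtr_sqr ler_wsqrtr //.
  by nra.
apply: (le_trans (sqrt_defect_le a0 b0 C0 Cab)).
have r0 : 0 < Num.sqrt (M + m) by rewrite sqrtr_gt0.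
have t0 : 0 <= 1 / 2 * ((M - m) / Num.sqrt (M + m)) * b.
  by rewrite !mulr_ge0 ?invr_ge0 ?(ltW r0) // subr_ge0 ltW.
rewrite -[leRHS]ger0_norm // -sqrtr_sqr ler_wsqrtr //.
rewrite !exprMn !exprVn (sqr_sqrtr (ltW k0)) -(ler_pM2l k0).
have -> : (M + m) * ((1 ^+ 2 * 2 ^- 2) * ((M - m) ^+ 2 / (M + m)) * b ^+ 2)
        = (M - m) ^+ 2 * b ^+ 2 / 4 by field; rewrite gt_eqF.
(* Completing the square: [(a - m * b) * (M * b - a)] is [(M - m) ^+ 2 * b ^+ 2 / 4] minus this
   square. *)
have := sqr_ge0 (a - (M + m) / 2 * b).
by nra.
Qed.

Lemma det_block11 (R : comPzRingType) (a b c d : R) :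
  \det (block_mx a%:M b%:M c%:M d%:M : 'M[R]_(1 + 1)) = a * d - b * c.
Proof.
(* Block entries are read through [fintype.split]; [s0] and [s1] evaluate it from the numerical
   value of the index. *)
have s0 (i : 'I_(1 + 1)) : val i = 0%N -> fintype.split i = inl ord0.
  move=> i0; rewrite -(unsplitK (inl ord0)); congr fintype.split.
  exact: val_inj.
have s1 (i : 'I_(1 + 1)) : val i = 1%N -> fintype.split i = inr ord0.
  move=> i1; rewrite -(unsplitK (inr ord0)); congr fintype.split.
  exact: val_inj.
rewrite (expand_det_row _ ord0) big_ord_recl big_ord1 /cofactor.
rewrite !det_mx11 !mxE (s0 ord0) ?(s1 (lift ord0 0)) // !mxE.
rewrite (s0 ord0) ?(s1 (lift ord0 _)) ?(s0 (lift (lift ord0 ord0) 0)) // !mxE /=.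
by rewrite expr0 expr1 mul1r mulN1r mulrN.
Qed.

Section WeightedInnerProduct.
Context {d : measure_display} {T : measurableType d} {R : realType}.
Context (mu : {measure set T -> \bar R}).

(** [F] agrees a.e. with its absolute value, so both have the same integral. *)
Lemma Rintegral_ae_ge0 (F : T -> R) : measurable_fun setT F ->
  {ae mu, forall x, 0 <= F x} -> 0 <= Rintegral mu setT F.
Proof.
move=> mF F0; rewrite /Rintegral.
rewrite (ae_eq_integral (fun x => (`|F x|)%:E)) //.
- by apply: fine_ge0; apply: integral_ge0 => x _; rewrite lee_fin.
- exact/measurable_EFinP.
- exact/measurable_EFinP/measurableT_comp.
- by apply: filterS F0 => x Fx0 _; rewrite ger0_norm.
Qed.

Context (rho : T -> R) (rho_meas : measurable_fun setT rho).
Context (rho_ge0 : forall x : T, 0 <= rho x).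

Local Notation ip := (weighted_ip mu rho).
Local Notation L2 := (weightedL2 mu rho).

Lemma weighted_measurable (u v : T -> R) : L2 u -> L2 v ->
  measurable_fun setT (fun x => rho x * u x * v x).
Proof. by move=> [mu_ _] [mv _]; do 2!apply: measurable_funM => //. Qed.

Lemma weighted_sqr_integrable (u : T -> R) : L2 u ->
  mu.-integrable setT (EFin \o (fun x => rho x * u x * u x)).
Proof.
move=> Lu; apply/integrableP; split.
  by apply/measurable_EFinP; exact: weighted_measurable.
have [_] := Lu; congr (_ < _)%E; apply: eq_integral => x _ /=.
by rewrite !normrM (ger0_norm (rho_ge0 x)) -mulrA.
Qed.

(** The integrand is dominated by [rho * (u ^+ 2 + v ^+ 2)]. *)
Lemma weighted_integrable (u v : T -> R) : L2 u -> L2 v ->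
  mu.-integrable setT (EFin \o (fun x => rho x * u x * v x)).
Proof.
move=> Lu Lv.
have := integrableD measurableT (weighted_sqr_integrable Lu)
  (weighted_sqr_integrable Lv).
apply: le_integrable => //.
  by apply/measurable_EFinP; exact: weighted_measurable.
move=> x _ /=; rewrite lee_fin -!mulrA -mulrDr !normrM ler_wpM2l //.
have e (z : R) : z * z = `|z| ^+ 2 by rewrite real_normK ?num_real // expr2.
rewrite !e (ger0_norm (addr_ge0 (sqr_ge0 _) (sqr_ge0 _))).
by have := sqr_ge0 (`|u x| - `|v x|); have := sqr_ge0 (`|u x| + `|v x|); nra.
Qed.

Lemma weightedL2_lincomb (a b : R) (u v : T -> R) : L2 u -> L2 v ->
  L2 (fun x => a * u x + b * v x).
Proof.
move=> Lu Lv; split.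
  by case: Lu Lv => mu_ _ [mv _]; apply: measurable_funD;
    apply: measurable_funM.
have Iuu := integrableZl measurableT (a ^+ 2) (weighted_sqr_integrable Lu).
have Iuv := integrableZl measurableT (2 * a * b) (weighted_integrable Lu Lv).
have Ivv := integrableZl measurableT (b ^+ 2) (weighted_sqr_integrable Lv).
have /integrableP[_] :=
  integrableD measurableT (integrableD measurableT Iuu Iuv) Ivv.
congr (_ < _)%E; apply: eq_integral => x _ /=.
rewrite real_normK ?num_real //.
rewrite -[in RHS](ger0_norm (mulr_ge0 (rho_ge0 x) (sqr_ge0 _))).
by congr (`|_|%:E); ring.
Qed.

Lemma weighted_ipC (u v : T -> R) : ip u v = ip v u.
Proof. by apply: eq_Rintegral => x _; rewrite mulrAC. Qed.

Lemma weighted_ip_lincombl (a b : R) (u v w : T -> R) : L2 u -> L2 v -> L2 w ->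
  ip (fun x => a * u x + b * v x) w = a * ip u w + b * ip v w.
Proof.
move=> Lu Lv Lw; rewrite /weighted_ip.
have Iu := weighted_integrable Lu Lw.
have Iv := weighted_integrable Lv Lw.
rewrite -!RintegralZl // -RintegralD //; first last.
- exact: (integrableZl measurableT b Iv).
- exact: (integrableZl measurableT a Iu).
by apply: eq_Rintegral => x _; ring.
Qed.

Lemma weighted_ip_lincombr (a b : R) (u v w : T -> R) : L2 u -> L2 v -> L2 w ->
  ip w (fun x => a * u x + b * v x) = a * ip w u + b * ip w v.
Proof.
by move=> Lu Lv Lw; rewrite weighted_ipC weighted_ip_lincombl // !(weighted_ipC w).
Qed.

(** When [ip h h] is nonzero, this is [ip h h] times the inner product of the components of [u] and
    [v] orthogonal to [h]. *)
Definition gram (h u v : T -> R) : R := ip u v * ip h h - ip u h * ip v h.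

Lemma Gamma_gram (h u : T -> R) : Gamma mu rho h u = gram h u u.
Proof.
by rewrite /Gamma det_block11.
Qed.

Lemma gram_lincombl (h : T -> R) (a b : R) (u v w : T -> R) :
  L2 h -> L2 u -> L2 v -> L2 w ->
  gram h (fun x => a * u x + b * v x) w = a * gram h u w + b * gram h v w.
Proof.
by move=> Lh Lu Lv Lw; rewrite /gram !weighted_ip_lincombl //; ring.
Qed.

Lemma gramC (h u v : T -> R) : gram h u v = gram h v u.
Proof. by rewrite /gram (weighted_ipC u v) [ip u h * _]mulrC. Qed.

Lemma gram_lincombr (h : T -> R) (a b : R) (u v w : T -> R) :
  L2 h -> L2 u -> L2 v -> L2 w ->
  gram h w (fun x => a * u x + b * v x) = a * gram h w u + b * gram h w v.
Proof.
by move=> Lh Lu Lv Lw; rewrite gramC gram_lincombl // !(gramC _ w).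
Qed.

Lemma chebyshev_gram_ge0 (h u v : T -> R) : L2 h -> L2 u -> L2 v ->
  {ae mu, forall x, {ae mu, forall y,
    0 <= (u x * h y - h x * u y) * (v x * h y - h x * v y)}} ->
  0 <= gram h u v.
Proof.
move=> Lh Lu Lv sync.
(* [u x * p x + h x * q x] is the value of the inner integral over y. The form [_ + - _ * _] lets
   the linear-combination lemmas apply. *)
pose p x := ip h h * v x + - ip h v * h x.
pose q x := ip u v * h x + - ip u h * v x.
have Lp : L2 p by exact: weightedL2_lincomb.
have Lq : L2 q by exact: weightedL2_lincomb.
have pq_ge0 : {ae mu, forall x, 0 <= rho x * u x * p x + rho x * h x * q x}.
  apply: filterS sync => x syncx.
  pose u' y := u x * h y + - h x * u y.
  pose v' y := v x * h y + - h x * v y.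
  have Lu' : L2 u' by exact: weightedL2_lincomb.
  have Lv' : L2 v' by exact: weightedL2_lincomb.
  have : 0 <= ip u' v'.
    apply: Rintegral_ae_ge0; first exact: weighted_measurable.
    apply: filterS syncx => y syncxy.
    by rewrite -mulrA mulr_ge0 // /u' /v' !mulNr.
  rewrite weighted_ip_lincombl // !weighted_ip_lincombr // => ip_ge0.
  have := mulr_ge0 (rho_ge0 x) ip_ge0.
  by congr (_ <= _); rewrite /p /q; ring.
have : 0 <= ip u p + ip h q.
  rewrite /weighted_ip -RintegralD //; try exact: weighted_integrable.
  apply: Rintegral_ae_ge0 => //.
  by apply: measurable_funD; exact: weighted_measurable.
(* The outer integral expands to twice [gram h u v]. *)
rewrite !weighted_ip_lincombr // /gram (weighted_ipC h v).
by lra.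
Qed.

Lemma gram_ge0 (h u : T -> R) : L2 h -> L2 u -> 0 <= gram h u u.
Proof.
move=> Lh Lu; apply: chebyshev_gram_ge0 => //.
by apply: aeW => x; apply: aeW => y; rewrite -expr2 sqr_ge0.
Qed.

(** The form is nonnegative at every [s * u + t * v], so its discriminant has a sign. *)
Lemma gram_cauchy_schwarz (h u v : T -> R) : L2 h -> L2 u -> L2 v ->
  gram h u v ^+ 2 <= gram h u u * gram h v v.
Proof.
move=> Lh Lu Lv; apply: discriminant_le; last exact: gram_ge0.
move=> s t.
have Lst : L2 (fun x => s * u x + t * v x) by exact: weightedL2_lincomb.
have := gram_ge0 Lh Lst.
rewrite gram_lincombl // !gram_lincombr // (gramC h v u).
by congr (_ <= _); ring.
Qed.

End WeightedInnerProduct.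

Theorem proposition4 (d : measure_display) (T : measurableType d)
    (R : realType) (mu : {measure set T -> \bar R}) (rho : T -> R)
    (rho_meas : measurable_fun setT rho) (rho_gt0 : forall x : T, 0 < rho x)
    (M m : R) (m_gt0 : 0 < m) (m_lt_M : m < M)
    (f g h : T -> R)
    (f_L2 : weightedL2 mu rho f) (g_L2 : weightedL2 mu rho g)
    (h_L2 : weightedL2 mu rho h)
    (h_neq0 : {ae mu, forall x, h x != 0})
    (sync : synchronous mu (fun x => M * (g x / h x) - f x / h x)
                           (fun x => f x / h x - m * (g x / h x))) :
  0 <= Num.sqrt (Gamma mu rho h f) + Num.sqrt (Gamma mu rho h g)
       - Num.sqrt (Gamma mu rho h (fun x => f x + g x)) /\
  Num.sqrt (Gamma mu rho h f) + Num.sqrt (Gamma mu rho h g)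
       - Num.sqrt (Gamma mu rho h (fun x => f x + g x))
    <= 1 / 2 * ((M - m) / Num.sqrt (M + m)) * Num.sqrt (Gamma mu rho h g).
Proof.
have rho_ge0 x : 0 <= rho x by exact: ltW.
pose u x := M * g x + - 1 * f x.
pose v x := 1 * f x + - m * g x.
have Lu : weightedL2 mu rho u by exact: weightedL2_lincomb.
have Lv : weightedL2 mu rho v by exact: weightedL2_lincomb.
have : 0 <= gram mu rho h u v.
  apply: chebyshev_gram_ge0 => //.
  apply: filterS2 (h_neq0) sync => x hx syncx.
  apply: filterS2 (h_neq0) syncx => y hy.
  (* The factor [(h x * h y) ^+ 2] clears the denominators: one [h x * h y] turns each difference of
     quotients into a cross difference such as [u x * h y - h x * u y]. *)
  move=> /(mulr_ge0 (sqr_ge0 (h x * h y))).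
  by congr (_ <= _); rewrite /u /v; field; rewrite hx hy.
(* By bilinearity and symmetry, [gram_uv] becomes the hypothesis on [A], [B], [C] in
   [sqrt_reverse_triangle_bounds], up to rearrangement. *)
rewrite gram_lincombl // !gram_lincombr // (gramC _ _ _ g f) => gram_uv.
rewrite !Gamma_gram.
have -> : gram mu rho h (fun x => f x + g x) (fun x => f x + g x)
   = gram mu rho h f f + gram mu rho h g g + 2 * gram mu rho h f g.
  have -> : (fun x => f x + g x) = (fun x => 1 * f x + 1 * g x).
    by apply/funext => x; rewrite !mul1r.
  have Lfg := weightedL2_lincomb rho_meas rho_ge0 1 1 f_L2 g_L2.
  rewrite gram_lincombl // !gram_lincombr // (gramC _ _ _ g f).
  by ring.
apply: sqrt_reverse_triangle_bounds => //.
- exact: gram_ge0.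
- exact: gram_ge0.
- exact: gram_cauchy_schwarz.
- by lra.
Qed.
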